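(* Let $\mu\in\mathbb{R}$, let $\psi=(\psi^{0},\psi^{\infty})$ be a pair with $\psi^{0}$ a germ of biholomorphism at $0$ satisfying $(\psi^{0})'(0)=\exp(4\pi^{2}\mu)$ and $\psi^{\infty}$ a germ of biholomorphism at $\infty\in\overline{\mathbb{C}}$ tangent to the identity, and let $0<\lambda\le\lambda(\psi)$. Let $\Delta$ be the spherical normal form of $\psi$ with parameters $\mu,\lambda$. If moreover $$\overline{\psi^{0}\left(\overline{h}\right)}=\frac{e^{4\pi^{2}\mu}}{\psi^{\infty}\left(\frac{1}{h}\right)}\qquad\text{for all }h\text{ in a neighborhood of }0,$$ then $\Delta$ is real, that is, it commutes with the complex conjugation.
   Context: Notation. $\mathrm{Parab}_{1}$ is the set of germs $z+az^{2}+o(z^{2})$ at $0$, $a\in\mathbb{C}^{\times}$. For $X=R\frac{\partial}{\partial z}$, $X\cdot G=RG'$. $$X_{0}(z)=\frac{1-z^{2}}{1+z^{2}}\times\frac{\lambda z^{2}}{1+\mu\lambda z-z^{2}}\frac{\partial}{\partial z},\qquad V^{\pm}=\{z\neq0:\ |\arg(\pm z)|<\tfrac{5\pi}{8}\}.$$ $V^{\cap}=V^{+}\cap V^{-}=V^{0}\sqcup V^{\infty}$, $V^{0}$ (resp. $V^{\infty}$) being the component in $\{\operatorname{Im}z>0\}$ (resp. $\{\operatorname{Im}z<0\}$). A pair $(f^{+},f^{-})$ of functions holomorphic on $V^{+}$, $V^{-}$ is the $1$-sum of $F=\sum F_nz^n$ if $\limsup_{z\to0,z\in V^{\cap}}|z|\ln|f^{-}-f^{+}|<0$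 and $|f^{\pm}(z)-\sum_{n=0}^{N}F_{n}z^{n}|\le C(N+1)!|z|^{N+1}$ for some $C>0$, all $N$ and all $z\in V^{\pm}$ near $0$. Let $H_{0}(z)=\left(\frac{\lambda z}{1-z^{2}}\right)^{2i\pi\mu}\exp\left(-2i\pi\frac{1-z^{2}}{\lambda z}\right)$, with the determination on $V^{+}\setminus[1,+\infty)$ for which $\log\frac{\lambda z}{1-z^{2}}$ is real on $(0,1)$ and the determination on $V^{-}\setminus(-\infty,-1]$ which coincides with it on $V^{\infty}$. Spherical normal form. $\lambda(\psi)>0$ is a number such that for every $0<\lambda\le\lambda(\psi)$ there exists a unique $F\in z\mathbb{C}[[z]]$ with the following properties (such a number exists): the time-$1$ map $\Delta=\exp(X_{F})\cdot\mathrm{Id}$ of the formal vector field $X_{F}=\frac{1}{1+X_{0}\cdot F}X_{0}$ is convergent at $0$ and belongs to $\mathrm{Parab}_{1}$; $F$ has a $1$-sum $(f^{+},f^{-})$ holomorphic and bounded by $1$ on $V^{\pm}$; the Birkhoff--Écalle--Voronin modulus of $\Delta$ is $(\psi^{0},\psi^{\infty})$, that is, with $H^{\pm}=H_{0}\exp(2i\pi f^{\pm})$ one has $H^{-}=\psi^{\sharp}\circ H^{+}$ on $V^{\sharp}$ near $0$ for $\sharp\in\{0,\infty\}$. The germ $\Delta$ is the spherical normal form of $\psi$ with parameters $\mu,\lambda$. *)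

(* Defs.v *)
From Stdlib Require Import Reals List Factorial.
From Coquelicot Require Import Coquelicot.
Import ListNotations.

Open Scope R_scope.

Definition Cexp (z : C) : C :=
  (exp (Re z) * cos (Im z), exp (Re z) * sin (Im z)).

Definition holomorphic_on (D : C -> Prop) (f : C -> C) : Prop :=
  forall z, D z -> ex_derive f z.

Definition holomorphic_germ (f : C -> C) : Prop :=
  locally (RtoC 0) (fun z => ex_derive f z).

(** Germs are represented by functions on [C], only the values near the base
    point being relevant. A biholomorphism germ at 0 fixes 0. *)
Definition biholomorphism_germ_0 (f : C -> C) : Prop :=
  holomorphic_germ f /\ f (RtoC 0) = RtoC 0 /\
  exists g : C -> C,
    holomorphic_germ g /\ g (RtoC 0) = RtoC 0 /\
    locally (RtoC 0) (fun z => g (f z) = z) /\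
    locally (RtoC 0) (fun z => f (g z) = z).

(** A germ at infinity fixing infinity is represented by its values on
    [{R < |h| < +oo}], for [R] large; this is its expression in the
    coordinate [u = 1/h], where infinity becomes [u = 0]. If [at_infinity f]
    is a biholomorphism germ then [f] does not vanish near infinity: by the
    convention [/ 0 = 0], a zero of [f] would be mapped to 0, the image of
    [u = 0]. *)
Definition at_infinity (f : C -> C) (u : C) : C :=
  if Ceq_dec u (RtoC 0) then RtoC 0 else (/ f (/ u))%C.

(** Tangency to the identity is read in the coordinate [1/h]. *)
Definition tangent_to_id_at_infinity (f : C -> C) : Prop :=
  is_derive (at_infinity f) (RtoC 0) (RtoC 1).

Definition Parab1 (D : C -> C) : Prop :=
  holomorphic_germ D /\
  exists a : C, a <> RtoC 0 /\
    forall eps : posreal,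
      locally (RtoC 0) (fun z =>
        Cmod (D z - (z + a * z ^ 2))%C <= eps * Cmod z ^ 2).

Definition commutes_with_conj (D : C -> C) : Prop :=
  locally (RtoC 0) (fun z => D (Cconj z) = Cconj (D z)).

Definition ps_poly (l : list C) : nat -> C := fun n => nth n l (RtoC 0).

Definition ps_one : nat -> C := ps_poly [RtoC 1].

Definition ps_id : nat -> C := ps_poly [RtoC 0; RtoC 1].

Definition ps_add (a b : nat -> C) : nat -> C := fun n => (a n + b n)%C.

Definition ps_sub (a b : nat -> C) : nat -> C := fun n => (a n - b n)%C.

Definition ps_mul (a b : nat -> C) : nat -> C :=
  fun n => sum_n (fun k => (a k * b (n - k)%nat)%C) n.

Definition ps_deriv (a : nat -> C) : nat -> C :=
  fun n => (RtoC (INR (S n)) * a (S n))%C.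

(** Inverse of a series with constant term 1, as [sum_k (1 - a)^k]. The terms
    with [k > n] do not contribute to the coefficient of [z^n], since [1 - a]
    has no constant term. *)
Definition ps_inv (a : nat -> C) : nat -> C :=
  fun n => sum_n (fun k => Nat.iter k (ps_mul (ps_sub ps_one a)) ps_one n) n.

Definition vf_act (R G : nat -> C) : nat -> C := ps_mul R (ps_deriv G).

(** [exp X . Id = sum_m (1 / m!) X^m . Id] for the formal vector field
    [X = R d/dz]. For [R] in [z^2 C[[z]]] the series [X^m . Id] is in
    [z^(m+1) C[[z]]], so that only [m <= n] matters in the coefficient
    of [z^n]. *)
Definition time_one_map (R : nat -> C) : nat -> C :=
  fun n => sum_n (fun m =>
    (RtoC (/ INR (fact m)) * Nat.iter m (vf_act R) ps_id n)%C) n.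

Definition converges_to_germ (a : nat -> C) (D : C -> C) : Prop :=
  locally (RtoC 0) (fun z => is_pseries a z (D z)).

(** Taylor series at 0 of the coefficient of [X_0], i.e. of
    [(1 - z^2) / (1 + z^2) * (lambda z^2) / (1 + mu lambda z - z^2)]. *)
Definition X0 (mu lambda : R) : nat -> C :=
  ps_mul
    (ps_mul (ps_poly [RtoC 1; RtoC 0; RtoC (-1)])
            (ps_poly [RtoC 0; RtoC 0; RtoC lambda]))
    (ps_inv
      (ps_mul (ps_poly [RtoC 1; RtoC 0; RtoC 1])
              (ps_poly [RtoC 1; RtoC (mu * lambda); RtoC (-1)]))).

Definition XF (mu lambda : R) (F : nat -> C) : nat -> C :=
  ps_mul (ps_inv (ps_add ps_one (vf_act (X0 mu lambda) F))) (X0 mu lambda).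

Definition Vplus (z : C) : Prop :=
  exists r theta : R,
    0 < r /\ Rabs theta < 5 * PI / 8 /\ z = (r * cos theta, r * sin theta).

Definition Vminus (z : C) : Prop := Vplus (- z)%C.

Definition Vcap (z : C) : Prop := Vplus z /\ Vminus z.

Definition Vzero (z : C) : Prop := Vcap z /\ 0 < Im z.

Definition Vinfty (z : C) : Prop := Vcap z /\ Im z < 0.

Definition Vplus_slit (z : C) : Prop :=
  Vplus z /\ ~ (Im z = 0 /\ 1 <= Re z).

Definition Vminus_slit (z : C) : Prop :=
  Vminus z /\ ~ (Im z = 0 /\ Re z <= -1).

Definition Rbar_ln (x : R) : Rbar :=
  if Rle_dec x 0 then m_infty else Finite (ln x).

(** Limit superior of [g z] as [z] tends to 0 in [A] (with [0] not in [A]). *)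
Definition limsup_at_0 (A : C -> Prop) (g : C -> Rbar) : Rbar :=
  Rbar_glb (fun s => exists d : R, 0 < d /\
    s = Rbar_lub (fun x => exists z : C, A z /\ Cmod z < d /\ x = g z)).

Definition gevrey_bound (K : R) (F : nat -> C) (f : C -> C) (z : C) : Prop :=
  forall N : nat,
    Cmod (f z - sum_n (fun n => (F n * z ^ n)%C) N)%C
      <= K * INR (fact (N + 1)) * Cmod z ^ (N + 1).

Definition is_one_sum (F : nat -> C) (fp fm : C -> C) : Prop :=
  holomorphic_on Vplus fp /\ holomorphic_on Vminus fm /\
  Rbar_lt
    (limsup_at_0 Vcap (fun z =>
       Rbar_mult (Finite (Cmod z)) (Rbar_ln (Cmod (fm z - fp z)%C))))
    (Finite 0) /\
  exists K : R, 0 < K /\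
    locally (RtoC 0) (fun z =>
      (Vplus z -> gevrey_bound K F fp z) /\
      (Vminus z -> gevrey_bound K F fm z)).

(** [lp] and [lm] are the determinations of [log (lambda z / (1 - z^2))] on
    [V^+ \ [1, +oo)] and [V^- \ (-oo, -1]] used in [H_0]. *)
Definition log_determinations (lambda : R) (lp lm : C -> C) : Prop :=
  continuous_on Vplus_slit lp /\
  (forall z, Vplus_slit z ->
     Cexp (lp z) = (RtoC lambda * z / (RtoC 1 - z ^ 2))%C) /\
  (forall x : R, 0 < x < 1 -> Im (lp (RtoC x)) = 0) /\
  continuous_on Vminus_slit lm /\
  (forall z, Vminus_slit z ->
     Cexp (lm z) = (RtoC lambda * z / (RtoC 1 - z ^ 2))%C) /\
  (forall z, Vinfty z -> lm z = lp z).

(** [H_0(z)], where [l] is the chosen determination of the logarithm. *)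
Definition H0 (mu lambda : R) (l : C -> C) (z : C) : C :=
  (Cexp (RtoC (2 * PI * mu) * Ci * l z)
   * Cexp (- (RtoC (2 * PI) * Ci
              * ((RtoC 1 - z ^ 2) / (RtoC lambda * z)))))%C.

Definition H (mu lambda : R) (l f : C -> C) (z : C) : C :=
  (H0 mu lambda l z * Cexp (RtoC (2 * PI) * Ci * f z))%C.

Definition has_modulus (mu lambda : R) (fp fm psi0 psiinf : C -> C) : Prop :=
  exists lp lm : C -> C,
    log_determinations lambda lp lm /\
    locally (RtoC 0) (fun z => Vzero z ->
      H mu lambda lm fm z = psi0 (H mu lambda lp fp z)) /\
    locally (RtoC 0) (fun z => Vinfty z ->
      H mu lambda lm fm z = psiinf (H mu lambda lp fp z)).

Definition spherical_series
    (mu lambda : R) (psi0 psiinf : C -> C) (F : nat -> C) : Prop :=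
  F 0%nat = RtoC 0 /\
  (exists D : C -> C,
     converges_to_germ (time_one_map (XF mu lambda F)) D /\ Parab1 D) /\
  exists fp fm : C -> C,
    is_one_sum F fp fm /\
    (forall z, Vplus z -> Cmod (fp z) <= 1) /\
    (forall z, Vminus z -> Cmod (fm z) <= 1) /\
    has_modulus mu lambda fp fm psi0 psiinf.

(** The property required of the number [lambda(psi)]. *)
Definition admissible_bound
    (mu : R) (psi0 psiinf : C -> C) (lambda_psi : R) : Prop :=
  0 < lambda_psi /\
  forall lambda : R, 0 < lambda <= lambda_psi ->
    exists! F : nat -> C, spherical_series mu lambda psi0 psiinf F.

Definition spherical_normal_form
    (mu lambda : R) (psi0 psiinf D : C -> C) : Prop :=
  exists F : nat -> C,
    spherical_series mu lambda psi0 psiinf F /\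
    converges_to_germ (time_one_map (XF mu lambda F)) D.

(* Main.v *)
Require Import Defs.
From Stdlib Require Import Reals Lra List FunctionalExtensionality.
From Coquelicot Require Import Coquelicot.
Import ListNotations.
Open Scope R_scope.

(** Reality follows from the uniqueness of the normal form. If [F], with 1-sum
    [(f^+, f^-)], is the series of the normal form of [psi], then the
    conjugate series, with 1-sum [z |-> conj (f^pm (conj z))], is again a
    normalizing series of the same [psi] ([spherical_series_conj]). Hence [F]
    has real coefficients, so does the time-one map, and a convergent series
    with real coefficients commutes with conjugation.

    All conditions on [F] but the one on the modulus are plainly invariant
    under conjugation, because [X0] is real and the sectors are symmetric. For
    the modulus, everything depends on the branches of the logarithm. The
    determination on [V^+] is real on (0, 1), hence symmetric
    ([lp_reflect]). The one on [V^-] agrees with it in the lower component,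
    so that its imaginary part is close to -pi on the negative axis, and
    conjugation shifts it by [2 i pi] ([lm_reflect]). As conjugation also
    changes the sign of [2 i pi], the first integrals [H^pm] of [F] and [G^pm]
    of the conjugate series satisfy ([H_reflect])
    [[
      conj (H^+ (conj z)) = 1 / G^+ z,
      conj (H^- (conj z)) = exp (4 pi^2 mu) / G^- z.
    ]]
    Since conjugation exchanges [V^0] and [V^infty], the relation
    [H^- = psi^infty o H^+] on [V^infty] becomes a relation between [G^+] and
    [G^-] on [V^0], which the symmetry assumed on [psi] identifies as
    [G^- = psi^0 o G^+]; likewise with 0 and infinity exchanged
    ([has_modulus_reflect]). The symmetry is known near [h = 0] only, so one
    also has to know that [H^+] tends to 0 at the origin in [V^0]
    ([H_small_on_Vzero]). *)

(** * Formal power series and complex conjugation *)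

Definition ps_conj (a : nat -> C) : nat -> C := fun n => Cconj (a n).

Lemma Cconj_RtoC (x : R) : Cconj (RtoC x) = RtoC x.
Proof. unfold Cconj, RtoC; simpl; f_equal; ring. Qed.

Lemma Cconj_neq_0 (z : C) : z <> RtoC 0 -> Cconj z <> RtoC 0.
Proof. intros Hz E. apply Hz. rewrite <- (Cconj_conj z), E. apply Cconj_RtoC. Qed.

Lemma Cconj_sum_n (u : nat -> C) (n : nat) :
  Cconj (sum_n u n) = sum_n (fun k => Cconj (u k)) n.
Proof.
  induction n as [|n IH].
  - now rewrite !sum_O.
  - rewrite !sum_Sn, <- IH. apply Cplus_conj.
Qed.

Lemma ps_conj_mul (a b : nat -> C) :
  ps_conj (ps_mul a b) = ps_mul (ps_conj a) (ps_conj b).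
Proof.
  extensionality n. unfold ps_conj, ps_mul. rewrite Cconj_sum_n.
  apply sum_n_ext; intros k. apply Cmult_conj.
Qed.

Lemma ps_conj_add (a b : nat -> C) :
  ps_conj (ps_add a b) = ps_add (ps_conj a) (ps_conj b).
Proof. extensionality n. apply Cplus_conj. Qed.

Lemma ps_conj_sub (a b : nat -> C) :
  ps_conj (ps_sub a b) = ps_sub (ps_conj a) (ps_conj b).
Proof. extensionality n. apply Cminus_conj. Qed.

Lemma ps_conj_deriv (a : nat -> C) :
  ps_conj (ps_deriv a) = ps_deriv (ps_conj a).
Proof.
  extensionality n. unfold ps_conj, ps_deriv.
  now rewrite Cmult_conj, Cconj_RtoC.
Qed.

Lemma ps_conj_poly (l : list C) : ps_conj (ps_poly l) = ps_poly (map Cconj l).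
Proof.
  extensionality n. unfold ps_conj, ps_poly.
  rewrite <- (map_nth Cconj). now rewrite Cconj_RtoC.
Qed.

Lemma ps_conj_one : ps_conj ps_one = ps_one.
Proof. unfold ps_one. rewrite ps_conj_poly; simpl. now rewrite Cconj_RtoC. Qed.

Lemma ps_conj_id : ps_conj ps_id = ps_id.
Proof. unfold ps_id. rewrite ps_conj_poly; simpl. now rewrite !Cconj_RtoC. Qed.

Lemma ps_conj_iter (T T' : (nat -> C) -> nat -> C) (a : nat -> C) (m : nat) :
  (forall b, ps_conj (T b) = T' (ps_conj b)) ->
  ps_conj (Nat.iter m T a) = Nat.iter m T' (ps_conj a).
Proof. intros HT. induction m as [|m IH]; simpl; now rewrite ?HT, ?IH. Qed.

Lemma ps_conj_inv (a : nat -> C) : ps_conj (ps_inv a) = ps_inv (ps_conj a).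
Proof.
  extensionality n. unfold ps_inv at 2, ps_conj at 1. unfold ps_inv.
  rewrite Cconj_sum_n. apply sum_n_ext; intros k.
  rewrite <- ps_conj_one at 4.
  rewrite <- (ps_conj_iter (ps_mul (ps_sub ps_one a))); [reflexivity|].
  intros b. now rewrite ps_conj_mul, ps_conj_sub, ps_conj_one.
Qed.

Lemma ps_conj_vf_act (A G : nat -> C) :
  ps_conj (vf_act A G) = vf_act (ps_conj A) (ps_conj G).
Proof. unfold vf_act. now rewrite ps_conj_mul, ps_conj_deriv. Qed.

Lemma ps_conj_time_one_map (A : nat -> C) :
  ps_conj (time_one_map A) = time_one_map (ps_conj A).
Proof.
  extensionality n. unfold time_one_map, ps_conj at 1.
  rewrite Cconj_sum_n. apply sum_n_ext; intros k.
  rewrite Cmult_conj, Cconj_RtoC.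
  f_equal. rewrite <- ps_conj_id at 2.
  rewrite <- (ps_conj_iter (vf_act A)); [reflexivity|].
  intros b. apply ps_conj_vf_act.
Qed.

Lemma ps_conj_X0 (mu lambda : R) : ps_conj (X0 mu lambda) = X0 mu lambda.
Proof.
  unfold X0. rewrite !ps_conj_mul, ps_conj_inv, !ps_conj_mul, !ps_conj_poly.
  simpl. now rewrite !Cconj_RtoC.
Qed.

Lemma ps_conj_XF (mu lambda : R) (F : nat -> C) :
  ps_conj (XF mu lambda F) = XF mu lambda (ps_conj F).
Proof.
  unfold XF. now rewrite ps_conj_mul, ps_conj_inv, ps_conj_add,
    ps_conj_vf_act, ps_conj_one, ps_conj_X0.
Qed.

(** * Reflection of functions across the real axis *)

(** The Schwarz reflection of [f], which conjugates the Taylor coefficients of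
    a germ at 0. *)
Definition reflect (f : C -> C) (z : C) : C := Cconj (f (Cconj z)).

Lemma Cminus_0_r (z : C) : (z - RtoC 0)%C = z.
Proof. ring. Qed.

Lemma locally_0_conj (P : C -> Prop) :
  locally (RtoC 0) P -> locally (RtoC 0) (fun z => P (Cconj z)).
Proof.
  intros [e He]. exists e. intros z [Hz1 Hz2]. apply He. split.
  - exact Hz1.
  - change (Rabs (- snd z - 0) < e). change (Rabs (snd z - 0) < e) in Hz2.
    replace (- snd z - 0) with (- (snd z - 0)) by ring. now rewrite Rabs_Ropp.
Qed.

Lemma locally_0_Cmod (P : C -> Prop) :
  locally (RtoC 0) P -> exists d : R, 0 < d /\ forall z, Cmod z < d -> P z.
Proof.
  intros [e He]. exists e. split; [apply cond_pos|]. intros z Hz. apply He.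
  apply C_NormedModule_mixin_compat1.
  change (Cmod (z - RtoC 0)%C < e). now rewrite Cminus_0_r.
Qed.

Lemma Cmod_locally_0 (d : R) : 0 < d -> locally (RtoC 0) (fun z => Cmod z < d).
Proof.
  intros Hd.
  generalize (locally_ball_norm (V := C_NormedModule) (RtoC 0) (mkposreal d Hd)).
  apply filter_imp. intros z Hz.
  change (Cmod (z - RtoC 0)%C < d) in Hz.
  now replace (z - RtoC 0)%C with z in Hz by (symmetry; exact (Cminus_0_r z)).
Qed.

(** Conjugation is antilinear, but it occurs twice: the difference quotient of
    [reflect f] at [z] is the conjugate of that of [f] at [Cconj z], so that the
    reflection is again complex differentiable. *)
Lemma is_derive_reflect (f : C -> C) (z l : C) :
  is_derive (K := C_AbsRing) (V := C_NormedModule) f (Cconj z) l ->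
  is_derive (K := C_AbsRing) (V := C_NormedModule) (reflect f) z (Cconj l).
Proof.
  intros [_ Hf]. split; [apply is_linear_scal_l|].
  intros x Hx eps.
  assert (E : z = x).
  { apply (is_filter_lim_locally_unique (V := AbsRing_NormedModule C_AbsRing)).
    exact Hx. }
  subst x.
  assert (Hc : is_filter_lim
      (@locally (AbsRing_UniformSpace C_AbsRing) (Cconj z)) (Cconj z))
    by (intros P HP; exact HP).
  destruct (Hf _ Hc eps) as [d Hd]. exists d. intros y Hy.
  specialize (Hd (Cconj y)).
  change (Cmod (y - z)%C < d) in Hy.
  change (Cmod (Cconj y - Cconj z)%C < d ->
    Cmod ((f (Cconj y) - f (Cconj z)) - (Cconj y - Cconj z) * l)%C
     <= eps * Cmod (Cconj y - Cconj z)%C) in Hd.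
  change (Cmod ((Cconj (f (Cconj y)) - Cconj (f (Cconj z))) - (y - z) * Cconj l)%C
     <= eps * Cmod (y - z)%C).
  rewrite <- Cminus_conj, Cmod_conj in Hd.
  rewrite <- (Cconj_conj (y - z)), <- Cmult_conj, <- !Cminus_conj, !Cmod_conj, Cminus_conj.
  rewrite Cminus_conj in Hd. now apply Hd.
Qed.

Lemma ex_derive_reflect (f : C -> C) (z : C) :
  ex_derive (K := C_AbsRing) (V := C_NormedModule) f (Cconj z) ->
  ex_derive (K := C_AbsRing) (V := C_NormedModule) (reflect f) z.
Proof. intros [l Hl]. exists (Cconj l). now apply is_derive_reflect. Qed.

Lemma Parab1_reflect (D : C -> C) : Parab1 D -> Parab1 (reflect D).
Proof.
  intros [Hol [a [Ha HD]]]. split.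
  - unfold holomorphic_germ in Hol |- *.
    generalize (locally_0_conj _ Hol). apply filter_imp.
    intros z. apply ex_derive_reflect.
  - exists (Cconj a). split.
    + now apply Cconj_neq_0.
    + intros eps. generalize (locally_0_conj _ (HD eps)). apply filter_imp.
      intros z Hz. unfold reflect.
      rewrite Cmod_conj in Hz.
      rewrite <- Cmod_conj, Cminus_conj, Cconj_conj, Cplus_conj, Cmult_conj,
        Cpow_conj, Cconj_conj.
      exact Hz.
Qed.

Lemma is_pseries_conj (a : nat -> C) (z l : C) :
  is_pseries (K := C_AbsRing) (V := C_NormedModule) a (Cconj z) l ->
  is_pseries (K := C_AbsRing) (V := C_NormedModule) (ps_conj a) z (Cconj l).
Proof.
  intros Hs.
  assert (Hc : filterlim Cconj (locally l) (locally (Cconj l))).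
  { intros P [e He]. exists e. intros y [Hy1 Hy2]. apply He. split.
    - exact Hy1.
    - change (Rabs (snd y - snd l) < e) in Hy2.
      change (Rabs (- snd y - - snd l) < e).
      replace (- snd y - - snd l) with (- (snd y - snd l)) by ring.
      now rewrite Rabs_Ropp. }
  generalize (filterlim_comp _ _ _ _ _ _ _ _ Hs Hc).
  apply filterlim_ext. intros n. rewrite Cconj_sum_n. apply sum_n_ext.
  intros k. unfold ps_conj.
  change (Cconj (pow_n (K := C_Ring) (Cconj z) k * a k)%C
          = (pow_n (K := C_Ring) z k * Cconj (a k))%C).
  rewrite Cmult_conj. f_equal.
  induction k as [|k IH].
  - apply Cconj_RtoC.
  - change (Cconj (Cconj z * pow_n (K := C_Ring) (Cconj z) k)%C
          = (z * pow_n (K := C_Ring) z k)%C).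
    now rewrite Cmult_conj, IH, Cconj_conj.
Qed.

Lemma converges_to_germ_reflect (a : nat -> C) (D : C -> C) :
  converges_to_germ a D -> converges_to_germ (ps_conj a) (reflect D).
Proof.
  unfold converges_to_germ. intros Ha. generalize (locally_0_conj _ Ha). apply filter_imp.
  intros z. apply is_pseries_conj.
Qed.

(** At a point and at its conjugate the two sums are sums of series with
    conjugate terms, so that the claim is the uniqueness of limits. *)
Lemma commutes_with_conj_of_real_series (a : nat -> C) (D : C -> C) :
  ps_conj a = a -> converges_to_germ a D -> commutes_with_conj D.
Proof.
  intros Ha HD. generalize (converges_to_germ_reflect _ _ HD). rewrite Ha.
  unfold commutes_with_conj. unfold converges_to_germ in HD |- *.
  intros HR. generalize (filter_and _ _ HD HR). intros HB.
  generalize (locally_0_conj _ HB). apply filter_imp.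
  intros z [H1 H2].
  generalize (filterlim_locally_unique (V := C_NormedModule) _ _ _ H1 H2).
  unfold reflect. now rewrite Cconj_conj.
Qed.

(** * Sectors and 1-sums *)

Lemma Vplus_conj (z : C) : Vplus z -> Vplus (Cconj z).
Proof.
  intros [r [t [Hr [Ht ->]]]]. exists r, (- t). rewrite Rabs_Ropp.
  repeat split; trivial.
  unfold Cconj; simpl. rewrite cos_neg, sin_neg. f_equal; ring.
Qed.

Lemma Vminus_conj (z : C) : Vminus z -> Vminus (Cconj z).
Proof. unfold Vminus. rewrite <- Copp_conj. apply Vplus_conj. Qed.

Lemma Vcap_conj (z : C) : Vcap z -> Vcap (Cconj z).
Proof. intros [? ?]. split; [now apply Vplus_conj | now apply Vminus_conj]. Qed.

Lemma Vzero_conj (z : C) : Vzero z -> Vinfty (Cconj z).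
Proof. intros [? ?]. split; [now apply Vcap_conj | rewrite im_conj; lra]. Qed.

Lemma Vinfty_conj (z : C) : Vinfty z -> Vzero (Cconj z).
Proof. intros [? ?]. split; [now apply Vcap_conj | rewrite im_conj; lra]. Qed.

Lemma limsup_at_0_conj (A : C -> Prop) (g : C -> Rbar) :
  (forall z, A z -> A (Cconj z)) ->
  limsup_at_0 A (fun z => g (Cconj z)) = limsup_at_0 A g.
Proof.
  intros HA. apply Rbar_glb_rw. intros s.
  assert (E : forall d, Rbar_lub (fun x => exists z, A z /\ Cmod z < d /\ x = g (Cconj z))
     = Rbar_lub (fun x => exists z, A z /\ Cmod z < d /\ x = g z)).
  { intros d. apply Rbar_lub_rw. intros x. split; intros [z [Hz [Hd ->]]].
    - exists (Cconj z). rewrite Cmod_conj. auto.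
    - exists (Cconj z). rewrite Cmod_conj, Cconj_conj. auto. }
  split; intros [d [Hd ->]]; exists d; (split; [exact Hd|]);
    [apply E | symmetry; apply E].
Qed.

Lemma gevrey_bound_reflect (K : R) (F : nat -> C) (f : C -> C) (z : C) :
  gevrey_bound K F f (Cconj z) -> gevrey_bound K (ps_conj F) (reflect f) z.
Proof.
  intros Hg N. specialize (Hg N). rewrite Cmod_conj in Hg.
  rewrite <- Cmod_conj, Cminus_conj, Cconj_sum_n in Hg.
  unfold reflect.
  rewrite (sum_n_ext _ (fun n => Cconj (F n * Cconj z ^ n)%C)); [exact Hg|].
  intros n. unfold ps_conj. now rewrite Cmult_conj, Cpow_conj, Cconj_conj.
Qed.

Lemma is_one_sum_reflect (F : nat -> C) (fp fm : C -> C) :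
  is_one_sum F fp fm -> is_one_sum (ps_conj F) (reflect fp) (reflect fm).
Proof.
  intros [Hp [Hm [Hl [K [HK Hg]]]]]. split; [|split; [|split]].
  - intros z Hz. apply ex_derive_reflect, Hp, Vplus_conj, Hz.
  - intros z Hz. apply ex_derive_reflect, Hm, Vminus_conj, Hz.
  - rewrite <- (limsup_at_0_conj Vcap) in Hl by exact Vcap_conj.
    match type of Hl with Rbar_lt (limsup_at_0 _ ?u) _ =>
      match goal with |- Rbar_lt (limsup_at_0 _ ?v) _ => replace v with u end end.
    { exact Hl. }
    extensionality z. unfold reflect.
    now rewrite <- Cminus_conj, !Cmod_conj.
  - exists K. split; [exact HK|].
    generalize (locally_0_conj _ Hg). apply filter_imp.
    intros z [H1 H2]. split; intros Hz; apply gevrey_bound_reflect.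
    + apply H1, Vplus_conj, Hz.
    + apply H2, Vminus_conj, Hz.
Qed.

(** * The determinations of the logarithm *)

Definition polar (r t : R) : C := (r * cos t, r * sin t).

Lemma Cmod_polar (r t : R) : 0 < r -> Cmod (polar r t) = r.
Proof.
  intros Hr. unfold Cmod, polar; simpl fst; simpl snd.
  replace ((r * cos t) ^ 2 + (r * sin t) ^ 2) with (r ^ 2).
  - apply sqrt_pow2; lra.
  - generalize (sin2_cos2 t). unfold Rsqr. intros E.
    replace ((r * cos t) ^ 2 + (r * sin t) ^ 2)
      with (r ^ 2 * (sin t * sin t + cos t * cos t)) by ring.
    rewrite E. ring.
Qed.

Lemma Cconj_polar (r t : R) : Cconj (polar r t) = polar r (- t).
Proof.
  unfold Cconj, polar; simpl. rewrite cos_neg, sin_neg. f_equal; ring.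
Qed.

Lemma Copp_polar (r t : R) : (- polar r t)%C = polar r (t + PI).
Proof.
  unfold Copp, polar; simpl. rewrite neg_cos, neg_sin. f_equal; ring.
Qed.

Lemma polar_2PI (r t : R) : polar r (t + 2 * PI) = polar r t.
Proof.
  unfold polar. rewrite cos_plus, sin_plus, cos_2PI, sin_2PI. f_equal; ring.
Qed.

Lemma continuous_polar (r t : R) : filterlim (polar r) (locally t) (locally (polar r t)).
Proof.
  unfold polar.
  apply (filterlim_filter_le_2 (G := filter_prod (locally (r * cos t)) (locally (r * sin t)))).
  { intros P [e He].
    exists (ball (r * cos t) e) (ball (r * sin t) e).
    - apply locally_ball.
    - apply locally_ball.
    - intros x y Hx Hy. apply He. now split. }
  apply filterlim_pair.
  - apply (continuous_mult (fun _ => r) cos); [apply continuous_const|apply continuous_cos].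
  - apply (continuous_mult (fun _ => r) sin); [apply continuous_const|apply continuous_sin].
Qed.

(** By the intermediate value theorem, an angle that leaves (-pi/2, pi/2) has a
    vanishing cosine at the moment of leaving. This replaces explicit
    determinations of the argument. *)
Lemma angle_stays_acute (u : R -> R) (a b : R) :
  (forall s, Rmin a b <= s <= Rmax a b -> continuity_pt u s) ->
  (forall s, Rmin a b <= s <= Rmax a b -> 0 < cos (u s)) ->
  Rabs (u a) < PI / 2 -> Rabs (u b) < PI / 2.
Proof.
  intros Hu Hcos Ha.
  set (p := fun s => a + s * (b - a)).
  assert (Hp : forall s, 0 <= s <= 1 -> Rmin a b <= p s <= Rmax a b).
  { intros s Hs. unfold p, Rmin, Rmax. destruct (Rle_dec a b); nra. }
  assert (Hpc : forall s, continuity_pt p s).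
  { intros s. apply derivable_continuous_pt. unfold p. apply derivable_pt_plus.
    - apply derivable_pt_const.
    - apply derivable_pt_mult; [apply derivable_pt_id | apply derivable_pt_const]. }
  assert (p0 : p 0 = a) by (unfold p; ring).
  assert (p1 : p 1 = b) by (unfold p; ring).
  assert (Huc : forall s, 0 <= s <= 1 -> continuity_pt (fun s => u (p s)) s).
  { intros s Hs. apply (continuity_pt_comp p u); [apply Hpc | apply Hu, Hp, Hs]. }
  apply Rabs_def2 in Ha. rewrite <- p0 in Ha.
  assert (Hlt : forall (v : R -> R) (c : R), (forall s, 0 <= s <= 1 -> continuity_pt v s) ->
    v 0 < c -> (forall s, 0 <= s <= 1 -> v s <> c) -> v 1 < c).
  { intros v c Hv H0 Hne. destruct (Rlt_le_dec (v 1) c) as [|[H1|H1]]; trivial.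
    - destruct (Ranalysis5.IVT_interv (fun s => v s - c) 0 1) as [s [Hs E]]; try lra.
      + intros s Hs. apply (continuity_pt_minus v (fun _ => c)); [now apply Hv|].
        apply continuity_pt_const. now intros ? ?.
      + exfalso. apply (Hne s Hs). lra.
    - exfalso. apply (Hne 1); lra. }
  apply Rabs_def1; rewrite <- p1.
  - apply (Hlt (fun s => u (p s))); trivial; [lra|].
    intros s Hs E. specialize (Hcos _ (Hp s Hs)). rewrite E, cos_PI2 in Hcos. lra.
  - assert (- u (p 1) < PI / 2); [|lra].
    apply (Hlt (fun s => - u (p s))); [|lra|].
    + intros s Hs. apply (continuity_pt_opp (fun s => u (p s))). now apply Huc.
    + intros s Hs E. specialize (Hcos _ (Hp s Hs)).
      rewrite <- cos_neg, E, cos_PI2 in Hcos. lra.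
Qed.

Lemma one_minus_sq_neq_0 (z : C) : Cmod z < 1 -> (RtoC 1 - z ^ 2)%C <> RtoC 0.
Proof.
  intros Hz E0. assert (E1 : (z ^ 2)%C = RtoC 1).
  { rewrite <- (Cplus_0_r (z ^ 2)), <- E0. ring. }
  apply (f_equal Cmod) in E1. rewrite Cmod_pow, Cmod_1 in E1.
  generalize (Cmod_ge_0 z). nra.
Qed.

(** The argument of [z / (1 - z^2)] differs from that of [z] by less than a
    right angle when [|z| < 1]: in that case [1 - z^2], hence also its inverse,
    has positive real part. *)
Lemma log_quotient_cos_pos (lambda r t : R) (w : C) :
  0 < lambda -> 0 < r < 1 ->
  Cexp w = (RtoC lambda * polar r t / (RtoC 1 - polar r t ^ 2))%C ->
  0 < cos (Im w - t).
Proof.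
  intros Hl Hr E.
  assert (Hz : (RtoC 1 - polar r t ^ 2)%C <> RtoC 0)
    by (apply one_minus_sq_neq_0; rewrite Cmod_polar; lra).
  assert (E2 : (Cexp w * (RtoC 1 - polar r t ^ 2))%C = (RtoC lambda * polar r t)%C).
  { rewrite E. field. exact Hz. }
  assert (Hp : 0 < exp (Re w)) by apply exp_pos.
  unfold Cexp, polar in E2. simpl in E2.
  injection E2 as Ea Eb.
  rewrite cos_minus.
  generalize (sin2_cos2 t). unfold Rsqr. intros Et.
  set (e := exp (Re w)) in *. set (ci := cos (Im w)) in *. set (si := sin (Im w)) in *.
  set (c := cos t) in *. set (s := sin t) in *.
  (* With [z = polar r t], [1 - z ^ 2 = p + i q]. *)
  set (p := 1 - r ^ 2 * (c * c - s * s)).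
  set (q := - (2 * r ^ 2 * c * s)).
  assert (Ea' : e * ci * p - e * si * q = lambda * (r * c)) by (unfold p, q; lra).
  assert (Eb' : e * ci * q + e * si * p = lambda * (r * s)) by (unfold p, q; lra).
  assert (Hpp : 0 < p).
  { unfold p. assert (c * c - s * s <= 1) by nra. assert (r ^ 2 < 1) by nra.
    assert (0 < r ^ 2) by nra. nra. }
  assert (Ec : e * (ci * c + si * s) * (p ^ 2 + q ^ 2) = lambda * r * p).
  { transitivity ((e * ci * p - e * si * q) * (p * c - q * s)
                 + (e * ci * q + e * si * p) * (p * s + q * c)); [|rewrite Ea', Eb'].
    - ring.
    - replace (lambda * (r * c) * (p * c - q * s) + lambda * (r * s) * (p * s + q * c))
        with (lambda * r * p * (s * s + c * c)) by ring.
      rewrite Et; ring. }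
  assert (Hpos : 0 < lambda * r * p) by (repeat apply Rmult_lt_0_compat; lra).
  rewrite <- Ec in Hpos.
  assert (Hq : 0 < p ^ 2 + q ^ 2) by nra.
  assert (H1 : 0 < e * (ci * c + si * s)).
  { apply (Rmult_lt_reg_r (p ^ 2 + q ^ 2)); lra. }
  apply (Rmult_lt_reg_l e); lra.
Qed.

Lemma continuity_pt_Im_polar (D : C -> Prop) (l : C -> C) (r t : R) :
  continuous_on D l ->
  locally t (fun s => D (polar r s)) ->
  continuity_pt (fun s => Im (l (polar r s)) - s) t.
Proof.
  intros Hl Ht. apply (continuity_pt_minus (fun s => Im (l (polar r s))) (fun s => s)).
  2: { apply derivable_continuous_pt, derivable_pt_id. }
  apply continuity_pt_filterlim.
  apply (filterlim_comp _ _ _ (fun s => l (polar r s)) Im _ (locally (l (polar r t)))).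
  - apply (filterlim_comp _ _ _ (polar r) l _ (within D (locally (polar r t)))).
    + intros P HP. generalize (continuous_polar r t _ HP). unfold filtermap.
      unfold within. generalize Ht. intros Ht1 Ht2. generalize (filter_and _ _ Ht1 Ht2).
      apply filter_imp. intros s [H1 H2]. now apply H2.
    + apply Hl. apply (locally_singleton _ _ Ht).
  - intros P [e He]. exists e. intros y [_ Hy]. now apply He.
Qed.

(** A determination of [log (lambda z / (1 - z^2))] that is within a right
    angle of [t0] on the ray of angle [t0] follows the angle along the whole
    arc, by continuity. *)
Lemma log_angle (D : C -> Prop) (lambda r a b t0 t : R) (l : C -> C) :
  0 < lambda -> 0 < r < 1 -> continuous_on D l ->
  (forall z, D z -> Cexp (l z) = (RtoC lambda * z / (RtoC 1 - z ^ 2))%C) ->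
  (forall s, a < s < b -> D (polar r s)) ->
  a < t0 < b -> a < t < b ->
  Rabs (Im (l (polar r t0)) - t0) < PI / 2 ->
  Rabs (Im (l (polar r t)) - t) < PI / 2.
Proof.
  intros Hl Hr Hc He HD Ht0 Ht H0.
  apply (angle_stays_acute (fun s => Im (l (polar r s)) - s) t0 t); trivial.
  - intros s Hs.
    assert (Hs' : a < s < b).
    { revert Hs. unfold Rmin, Rmax. destruct (Rle_dec t0 t); lra. }
    apply (continuity_pt_Im_polar D); trivial.
    apply (filter_imp (fun x => a < x /\ x < b)); [intros x Hx; now apply HD|].
    apply filter_and; [now apply open_gt | now apply open_lt].
  - intros s Hs.
    assert (Hs' : a < s < b).
    { revert Hs. unfold Rmin, Rmax. destruct (Rle_dec t0 t); lra. }
    apply (log_quotient_cos_pos lambda r); trivial. apply He, HD, Hs'.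
Qed.

Lemma Vplus_slit_polar (r t : R) :
  0 < r < 1 -> - (5 * PI / 8) < t < 5 * PI / 8 -> Vplus_slit (polar r t).
Proof.
  intros Hr Ht. split.
  - exists r, t. split; [lra|]. split; [apply Rabs_def1; lra | reflexivity].
  - intros [_ H1]. generalize (re_le_Cmod (polar r t)).
    rewrite Cmod_polar by lra. intros H2. generalize (Rle_abs (Re (polar r t))). lra.
Qed.

(** Angles in [V^-] are counted around -pi, so that they increase continuously
    to those of [V^infty], around -pi/2, where the two determinations of the
    logarithm agree. *)
Lemma Vminus_slit_polar (r t : R) :
  0 < r < 1 -> - PI - 5 * PI / 8 < t < - PI + 5 * PI / 8 -> Vminus_slit (polar r t).
Proof.
  intros Hr Ht. split.
  - unfold Vminus. rewrite Copp_polar. exists r, (t + PI).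
    split; [lra|]. split; [apply Rabs_def1; lra | reflexivity].
  - intros [_ H1]. generalize (re_le_Cmod (polar r t)).
    rewrite Cmod_polar by lra. intros H2.
    generalize (Rle_abs (- Re (polar r t))). rewrite Rabs_Ropp. lra.
Qed.

Lemma Vinfty_polar (r : R) : 0 < r -> Vinfty (polar r (- (PI / 2))).
Proof.
  intros Hr. generalize PI_RGT_0; intros Hpi. split; [split|].
  - exists r, (- (PI / 2)). repeat split; trivial. apply Rabs_def1; lra.
  - unfold Vminus. rewrite Copp_polar. exists r, (- (PI / 2) + PI).
    repeat split; trivial. apply Rabs_def1; lra.
  - simpl. rewrite sin_neg, sin_PI2. lra.
Qed.

Lemma lp_angle (lambda r t : R) (lp lm : C -> C) :
  0 < lambda -> log_determinations lambda lp lm -> 0 < r < 1 ->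
  - (5 * PI / 8) < t < 5 * PI / 8 ->
  Rabs (Im (lp (polar r t)) - t) < PI / 2.
Proof.
  intros Hl [Hc [He [H0 _]]] Hr Ht. generalize PI_RGT_0; intros Hpi.
  apply (log_angle Vplus_slit lambda r (- (5 * PI / 8)) (5 * PI / 8) 0); trivial; try lra.
  - intros s Hs. now apply Vplus_slit_polar.
  - replace (polar r 0) with (RtoC r).
    + rewrite (H0 r Hr), Rminus_0_r, Rabs_R0. lra.
    + unfold polar, RtoC. rewrite cos_0, sin_0. f_equal; ring.
Qed.

Lemma lm_angle (lambda r t : R) (lp lm : C -> C) :
  0 < lambda -> log_determinations lambda lp lm -> 0 < r < 1 ->
  - PI - 5 * PI / 8 < t < - PI + 5 * PI / 8 ->
  Rabs (Im (lm (polar r t)) - t) < PI / 2.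
Proof.
  intros Hl HL Hr Ht. generalize PI_RGT_0; intros Hpi.
  assert (H0 : Rabs (Im (lp (polar r (- (PI / 2)))) - - (PI / 2)) < PI / 2)
    by (apply (lp_angle lambda r _ lp lm); trivial; lra).
  destruct HL as [_ [_ [_ [Hc [He Heq]]]]].
  apply (log_angle Vminus_slit lambda r (- PI - 5 * PI / 8) (- PI + 5 * PI / 8)
           (- (PI / 2))); trivial; try lra.
  - intros s Hs. now apply Vminus_slit_polar.
  - rewrite Heq; [exact H0 | apply Vinfty_polar; lra].
Qed.

Lemma Cexp_conj (w : C) : Cexp (Cconj w) = Cconj (Cexp w).
Proof.
  unfold Cexp. rewrite re_conj, im_conj, cos_neg, sin_neg.
  unfold Cconj; simpl. f_equal; ring.
Qed.

Lemma Cexp_plus (a b : C) : Cexp (a + b) = (Cexp a * Cexp b)%C.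
Proof.
  unfold Cexp, Cmult; simpl. unfold Re, Im; simpl.
  rewrite exp_plus, cos_plus, sin_plus. f_equal; ring.
Qed.

Lemma Cmod_Cexp (w : C) : Cmod (Cexp w) = exp (Re w).
Proof. apply (Cmod_polar (exp (Re w)) (Im w)), exp_pos. Qed.

Lemma Cexp_neq_0 (w : C) : Cexp w <> RtoC 0.
Proof. apply Cmod_gt_0. rewrite Cmod_Cexp. apply exp_pos. Qed.

Lemma Cexp_RtoC (x : R) : Cexp (RtoC x) = RtoC (exp x).
Proof.
  unfold Cexp, RtoC; simpl. rewrite cos_0, sin_0. f_equal; ring.
Qed.

Lemma cos_eq_1_small (x : R) : cos x = 1 -> Rabs x < PI -> x = 0.
Proof.
  intros Hc Hx. apply Rabs_def2 in Hx.
  assert (Hs : sin (x / 2) = 0).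
  { generalize (cos_2a_sin (x / 2)). replace (2 * (x / 2)) with x by field.
    rewrite Hc. intros E. nra. }
  destruct (Rtotal_order x 0) as [H|[H|H]]; trivial.
  - assert (0 < sin (- (x / 2))) by (apply sin_gt_0; lra). rewrite sin_neg in H0. lra.
  - assert (0 < sin (x / 2)) by (apply sin_gt_0; lra). lra.
Qed.

(** Two logarithms of the same number differ by a multiple of [2 i pi], here
    expressed by the equations on [c]; a rough estimate of their difference
    determines this multiple. *)
Lemma Cexp_eq_near (a b : C) (c : R) :
  Cexp a = Cexp b -> cos c = 1 -> sin c = 0 -> Rabs (Im a - Im b - c) < PI ->
  a = (b + RtoC c * Ci)%C.
Proof.
  intros E Hc Hs Hn.
  assert (Er : Re a = Re b).
  { apply exp_inv. now rewrite <- !Cmod_Cexp, E. }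
  injection E as E1 E2. rewrite Er in E1, E2.
  assert (Hp := exp_pos (Re b)).
  apply Rmult_eq_reg_l in E1; [|lra]. apply Rmult_eq_reg_l in E2; [|lra].
  assert (E3 : Im a - Im b - c = 0).
  { apply cos_eq_1_small; trivial.
    rewrite !cos_minus, Hc, Hs, E1, E2.
    generalize (sin2_cos2 (Im b)). unfold Rsqr. lra. }
  destruct a as [a1 a2], b as [b1 b2]. unfold Re, Im in *; simpl in *.
  unfold Cplus, Cmult; simpl. f_equal; lra.
Qed.

Lemma Cconj_log_quotient (lambda : R) (z : C) :
  (RtoC 1 - z ^ 2)%C <> RtoC 0 ->
  Cconj (RtoC lambda * Cconj z / (RtoC 1 - Cconj z ^ 2))%C
  = (RtoC lambda * z / (RtoC 1 - z ^ 2))%C.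
Proof.
  intros Hz.
  assert (E : (RtoC 1 - Cconj z ^ 2)%C = Cconj (RtoC 1 - z ^ 2)%C)
    by now rewrite Cminus_conj, Cpow_conj, Cconj_RtoC.
  rewrite Cdiv_conj, E, Cconj_conj, Cmult_conj, Cconj_conj, Cconj_RtoC; trivial.
  rewrite E. now apply Cconj_neq_0.
Qed.

Lemma lp_reflect (lambda : R) (lp lm : C -> C) (z : C) :
  0 < lambda -> log_determinations lambda lp lm -> Vplus z -> Cmod z < 1 ->
  reflect lp z = lp z.
Proof.
  intros Hl HL [r [t [Hr [Ht Ez]]]] Hz. fold (polar r t) in Ez. subst z.
  assert (Hnz := one_minus_sq_neq_0 _ Hz).
  rewrite Cmod_polar in Hz by exact Hr. apply Rabs_def2 in Ht.
  assert (A1 := lp_angle lambda r t lp lm Hl HL (conj Hr Hz) ltac:(lra)).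
  assert (A2 := lp_angle lambda r (- t) lp lm Hl HL (conj Hr Hz) ltac:(lra)).
  replace (lp (polar r t)) with (lp (polar r t) + RtoC 0 * Ci)%C by ring.
  apply Cexp_eq_near; [|apply cos_0|apply sin_0|].
  - destruct HL as [_ [He _]]. unfold reflect.
    rewrite Cexp_conj, !He, Cconj_log_quotient; trivial.
    + apply Vplus_slit_polar; lra.
    + rewrite Cconj_polar. apply Vplus_slit_polar; lra.
  - unfold reflect. rewrite im_conj, Cconj_polar.
    apply Rabs_def2 in A1, A2. apply Rabs_def1; lra.
Qed.

(** The shift by [2 i pi] appears because the imaginary parts at [z] and at its
    conjugate are near opposite values with respect to -pi, not to 0. *)
Lemma lm_reflect (lambda : R) (lp lm : C -> C) (z : C) :
  0 < lambda -> log_determinations lambda lp lm -> Vminus z -> Cmod z < 1 ->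
  reflect lm z = (lm z + RtoC (2 * PI) * Ci)%C.
Proof.
  intros Hl HL [r [t [Hr [Ht Ez]]]] Hz. fold (polar r t) in Ez.
  assert (Ez1 : z = polar r (t - PI)).
  { replace z with (- - z)%C by ring. rewrite Ez, Copp_polar.
    replace (t + PI) with (t - PI + 2 * PI) by ring. apply polar_2PI. }
  assert (Ez2 : Cconj z = polar r (- t - PI)).
  { rewrite Ez1, Cconj_polar.
    replace (- (t - PI)) with (- t - PI + 2 * PI) by ring. apply polar_2PI. }
  assert (Hnz := one_minus_sq_neq_0 _ Hz).
  assert (Hr1 : r < 1) by (rewrite Ez1, Cmod_polar in Hz; trivial).
  apply Rabs_def2 in Ht.
  assert (A1 := lm_angle lambda r (t - PI) lp lm Hl HL (conj Hr Hr1) ltac:(lra)).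
  assert (A2 := lm_angle lambda r (- t - PI) lp lm Hl HL (conj Hr Hr1) ltac:(lra)).
  rewrite <- Ez1 in A1. rewrite <- Ez2 in A2.
  apply Cexp_eq_near; [|apply cos_2PI|apply sin_2PI|].
  - destruct HL as [_ [_ [_ [_ [He _]]]]]. unfold reflect.
    rewrite Cexp_conj, !He, Cconj_log_quotient; trivial.
    + rewrite Ez1. apply Vminus_slit_polar; lra.
    + rewrite Ez2. apply Vminus_slit_polar; lra.
  - unfold reflect. rewrite im_conj.
    apply Rabs_def2 in A1, A2. apply Rabs_def1; lra.
Qed.

(** * The coordinate [H] and the modulus *)

Lemma H_neq_0 (mu lambda : R) (l f : C -> C) (z : C) : H mu lambda l f z <> RtoC 0.
Proof. unfold H, H0. repeat apply Cmult_neq_0; apply Cexp_neq_0. Qed.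

Lemma Vplus_neq_0 (z : C) : Vplus z -> z <> RtoC 0.
Proof.
  intros [r [t [Hr [_ ->]]]]. apply Cmod_gt_0.
  change (0 < Cmod (polar r t)). now rewrite Cmod_polar.
Qed.

Lemma Cconj_Ci : Cconj Ci = (- Ci)%C.
Proof. unfold Cconj, Ci, Copp; simpl. f_equal; ring. Qed.

(** In the exponent of [H], the term in [(1 - z^2) / (lambda z)] and the term in
    [f] are cancelled by their reflections, because [2 i pi] changes sign; only
    the asymmetry of the logarithm remains. *)
Lemma H_reflect (mu lambda : R) (l f : C -> C) (z : C) :
  0 < lambda -> z <> RtoC 0 ->
  (reflect (H mu lambda l f) z * H mu lambda l (reflect f) z)%C
  = Cexp (RtoC (2 * PI * mu) * Ci * (l z - reflect l z))%C.
Proof.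
  intros Hl Hz. unfold reflect at 1. unfold H, H0.
  rewrite <- !Cexp_plus, <- Cexp_conj, <- Cexp_plus. f_equal.
  assert (Hz' := Cconj_neq_0 _ Hz).
  assert (Hl' : RtoC lambda <> RtoC 0) by (intros E; injection E; lra).
  rewrite !Cplus_conj, Copp_conj, !Cmult_conj, Cconj_Ci, !Cconj_RtoC, Cdiv_conj
    by now apply Cmult_neq_0.
  rewrite Cminus_conj, Cpow_conj, Cmult_conj, Cconj_conj, !Cconj_RtoC.
  unfold reflect. ring.
Qed.

(** The aperture gives [|Re z| < cos (3 pi / 8) |z|]; the cruder bound
    [cos (pi / 3) = 1 / 2] is enough. *)
Lemma Vcap_Re_small (z : C) : Vcap z -> 2 * Rabs (Re z) <= Cmod z.
Proof.
  assert (HV : forall w, Vplus w -> - Cmod w <= 2 * Re w).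
  { intros w [r [t [Hr [Ht ->]]]]. fold (polar r t). rewrite Cmod_polar by exact Hr.
    generalize PI_RGT_0; intros Hpi.
    assert (Hc : - (1 / 2) <= cos t).
    { replace (- (1 / 2)) with (cos (2 * (PI / 3))) by (rewrite cos_2PI3; field).
      assert (Ha : cos t = cos (Rabs t)).
      { unfold Rabs. destruct (Rcase_abs t); trivial. now rewrite cos_neg. }
      rewrite Ha. generalize (Rabs_pos t); intros Hp.
      apply cos_decr_1; lra. }
    unfold Re, polar; simpl fst. nra. }
  intros [H1 H2]. apply HV in H1, H2. rewrite Cmod_opp in H2.
  unfold Re, Copp in *; simpl in H2.
  unfold Rabs. destruct (Rcase_abs (fst z)); lra.
Qed.

Lemma Vzero_Im_large (z : C) : Vzero z -> Cmod z <= 2 * Im z.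
Proof.
  intros [Hc Hi]. apply Vcap_Re_small in Hc.
  generalize (Cmod2_alt z) (Cmod_ge_0 z) (Rabs_pos (Re z)). intros E Hm Hp.
  rewrite <- (pow2_abs (Re z)) in E. nra.
Qed.

Lemma lp_Im_bound (lambda : R) (lp lm : C -> C) (z : C) :
  0 < lambda -> log_determinations lambda lp lm -> Vplus z -> Cmod z < 1 ->
  Rabs (Im (lp z)) <= 2 * PI.
Proof.
  intros Hl HL [r [t [Hr [Ht ->]]]] Hz. fold (polar r t) in *.
  rewrite Cmod_polar in Hz by exact Hr. apply Rabs_def2 in Ht.
  generalize (lp_angle lambda r t lp lm Hl HL (conj Hr Hz) ltac:(lra)). intros A.
  generalize PI_RGT_0; intros Hpi. apply Rabs_def2 in A. apply Rabs_le; lra.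
Qed.

Lemma Re_H0_exponent (lambda : R) (z : C) :
  0 < lambda -> z <> RtoC 0 -> 0 < Im z ->
  Re (- (RtoC (2 * PI) * Ci * ((RtoC 1 - z ^ 2) / (RtoC lambda * z))))%C
  <= - (2 * PI / lambda * (Im z / Cmod z ^ 2)).
Proof.
  intros Hl Hz Hi.
  assert (Hl' : RtoC lambda <> RtoC 0) by (intros E; injection E; lra).
  replace (- (RtoC (2 * PI) * Ci * ((RtoC 1 - z ^ 2) / (RtoC lambda * z))))%C
    with (RtoC (- (2 * PI / lambda)) * (Ci * (/ z - z)))%C.
  2: { rewrite RtoC_opp, RtoC_div by lra. field. now split. }
  rewrite Cmod2_alt.
  assert (Hm : 0 < Re z ^ 2 + Im z ^ 2) by nra.
  destruct z as [x y]. unfold Re, Im in *. simpl in *.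
  assert (Hc : 0 < 2 * PI / lambda).
  { apply Rdiv_lt_0_compat; generalize PI_RGT_0; lra. }
  match goal with |- ?A <= _ =>
    replace A with (- (2 * PI / lambda * (y / (x * (x * 1) + y * (y * 1)) + y)))
      by (field; lra) end.
  nra.
Qed.

(** The dominant factor of [H] has modulus at most
    [exp (- pi / (lambda |z|))] on [V^0], where [Im z >= |z| / 2]; the other two
    factors are bounded. *)
Lemma H_small_on_Vzero (mu lambda : R) (lp lm f : C -> C) (eps : R) :
  0 < lambda -> log_determinations lambda lp lm ->
  (forall z, Vplus z -> Cmod (f z) <= 1) -> 0 < eps ->
  locally (RtoC 0) (fun z => Vzero z -> Cmod (H mu lambda lp f z) < eps).
Proof.
  intros Hl HL Hf Heps. generalize PI_RGT_0; intros Hpi.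
  (* The first two terms bound the exponents of the factors coming from the
     logarithm and from [f]. *)
  set (M := 2 * PI * Rabs mu * (2 * PI) + 2 * PI + Rabs (ln eps) + 1).
  assert (HM : 0 < M).
  { unfold M. generalize (Rabs_pos mu) (Rabs_pos (ln eps)). intros.
    assert (0 <= 2 * PI * Rabs mu * (2 * PI)) 
      by (apply Rmult_le_pos; [apply Rmult_le_pos|]; lra).
    lra. }
  assert (Hd : 0 < PI / lambda / M) by (repeat apply Rdiv_lt_0_compat; lra).
  generalize (filter_and _ _ (Cmod_locally_0 _ Hd) (Cmod_locally_0 1 Rlt_0_1)).
  apply filter_imp. intros z [Hz1 Hz2] HV.
  assert (HVp : Vplus z) by apply HV.
  assert (Hz0 := Vplus_neq_0 _ HVp).
  assert (Hmz : 0 < Cmod z) by now apply Cmod_gt_0.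
  assert (HI := Vzero_Im_large _ HV).
  assert (Hlp := lp_Im_bound lambda lp lm z Hl HL HVp Hz2).
  assert (Hre := Re_H0_exponent lambda z Hl Hz0 (proj2 HV)).
  assert (Hfz : Rabs (Im (f z)) <= 1).
  { apply Rle_trans with (2 := Hf z HVp).
    apply Rle_trans with (2 := Rmax_Cmod (f z)). apply Rmax_r. }
  unfold H, H0. rewrite !Cmod_mult, !Cmod_Cexp, <- !exp_plus.
  rewrite <- (exp_ln eps) by exact Heps. apply exp_increasing.
  assert (E1 : Re (RtoC (2 * PI * mu) * Ci * lp z)%C = - (2 * PI * mu * Im (lp z))).
  { unfold Re, Im, Cmult, Ci, RtoC; simpl. ring. }
  assert (E2 : Re (RtoC (2 * PI) * Ci * f z)%C = - (2 * PI * Im (f z))).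
  { unfold Re, Im, Cmult, Ci, RtoC; simpl. ring. }
  rewrite E1, E2.
  assert (B1 : - (2 * PI * mu * Im (lp z)) <= 2 * PI * Rabs mu * (2 * PI)).
  { apply Rle_trans with (1 := Rle_abs _). rewrite Rabs_Ropp, !Rabs_mult.
    rewrite (Rabs_pos_eq 2), (Rabs_pos_eq PI) by lra.
    apply Rmult_le_compat_l; trivial. generalize (Rabs_pos mu). nra. }
  assert (B2 : - (2 * PI * Im (f z)) <= 2 * PI).
  { apply Rabs_le_between in Hfz. nra. }
  assert (B3 : M < 2 * PI / lambda * (Im z / Cmod z ^ 2)).
  { assert (HA : M < PI / lambda / Cmod z).
    { apply (Rmult_lt_reg_r (Cmod z)); trivial.
      apply (Rmult_lt_compat_l M) in Hz1; trivial.
      replace (PI / lambda / Cmod z * Cmod z) with (M * (PI / lambda / M)); trivial.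
      field. lra. }
    apply Rlt_le_trans with (1 := HA).
    replace (2 * PI / lambda * (Im z / Cmod z ^ 2))
      with (PI / lambda / Cmod z * (2 * Im z / Cmod z)) by (field; lra).
    rewrite <- (Rmult_1_r (PI / lambda / Cmod z)) at 1.
    apply Rmult_le_compat_l.
    - apply Rlt_le. repeat apply Rdiv_lt_0_compat; lra.
    - apply (Rmult_le_reg_r (Cmod z)); trivial.
      replace (2 * Im z / Cmod z * Cmod z) with (2 * Im z) by (field; lra). lra. }
  generalize (Rle_abs (- ln eps)). rewrite Rabs_Ropp. unfold M in B3. lra.
Qed.

(** On [V^0], the symmetry of [psi] is applied at [h = conj (G z)], and on
    [V^infty] at [h = 1 / G z], where [G] is the reflected first integral on
    [V^+]. Both are near 0 for [z] near 0. *)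
Lemma has_modulus_reflect (mu lambda : R) (fp fm psi0 psiinf : C -> C) :
  0 < lambda ->
  (forall z, Vplus z -> Cmod (fp z) <= 1) ->
  locally (RtoC 0) (fun h : C => h <> RtoC 0 ->
      Cconj (psi0 (Cconj h))
        = (RtoC (exp (4 * PI ^ 2 * mu)) / psiinf (/ h))%C) ->
  has_modulus mu lambda fp fm psi0 psiinf ->
  has_modulus mu lambda (reflect fp) (reflect fm) psi0 psiinf.
Proof.
  intros Hl Hf Hpsi [lp [lm [HL [M0 Minf]]]].
  exists lp, lm. split; [exact HL|].
  assert (Hf' : forall z, Vplus z -> Cmod (reflect fp z) <= 1).
  { intros z Hz. unfold reflect. rewrite Cmod_conj. apply Hf, Vplus_conj, Hz. }
  set (E := RtoC (exp (4 * PI ^ 2 * mu))) in *.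
  assert (HE : E <> RtoC 0).
  { intros E0. apply RtoC_inj in E0. generalize (exp_pos (4 * PI ^ 2 * mu)). lra. }
  assert (Rp : forall z, Vplus z -> Cmod z < 1 ->
    reflect (H mu lambda lp fp) z = (/ H mu lambda lp (reflect fp) z)%C).
  { intros z Hz Hz1. assert (A := H_reflect mu lambda lp fp z Hl (Vplus_neq_0 _ Hz)).
    rewrite (lp_reflect lambda lp lm z Hl HL Hz Hz1) in A.
    replace (RtoC (2 * PI * mu) * Ci * (lp z - lp z))%C with (RtoC 0) in A by ring.
    rewrite Cexp_RtoC, exp_0 in A.
    rewrite <- (Cmult_1_l (/ _)), <- A. field. apply H_neq_0. }
  assert (Rm : forall z, Vminus z -> Cmod z < 1 ->
    reflect (H mu lambda lm fm) z = (E / H mu lambda lm (reflect fm) z)%C).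
  { intros z Hz Hz1.
    assert (Hz0 : z <> RtoC 0).
    { apply Vplus_neq_0 in Hz. intros E0. apply Hz. rewrite E0. ring. }
    assert (A := H_reflect mu lambda lm fm z Hl Hz0).
    rewrite (lm_reflect lambda lp lm z Hl HL Hz Hz1) in A.
    replace (RtoC (2 * PI * mu) * Ci * (lm z - (lm z + RtoC (2 * PI) * Ci)))%C
      with (RtoC (4 * PI ^ 2 * mu)) in A.
    2: { unfold Cmult, Cminus, Cplus, Copp, RtoC, Ci; simpl. f_equal; ring. }
    rewrite Cexp_RtoC in A. fold E in A.
    rewrite <- A. field. apply H_neq_0. }
  destruct (locally_0_Cmod _ Hpsi) as [d [Hd Hpsi']].
  split.
  - generalize (filter_and _ _ (locally_0_conj _ Minf)
      (filter_and _ _ (Cmod_locally_0 1 Rlt_0_1)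
         (H_small_on_Vzero mu lambda lp lm (reflect fp) d Hl HL Hf' Hd))).
    apply filter_imp. intros z [Hm [Hz1 Hs]] Hz.
    specialize (Hm (Vzero_conj _ Hz)). specialize (Hs Hz).
    assert (HVp : Vplus z) by apply Hz. assert (HVm : Vminus z) by apply Hz.
    apply (f_equal Cconj) in Hm.
    change (reflect (H mu lambda lm fm) z
      = Cconj (psiinf (H mu lambda lp fp (Cconj z)))) in Hm.
    rewrite <- (Cconj_conj (H mu lambda lp fp (Cconj z))) in Hm.
    change (Cconj (H mu lambda lp fp (Cconj z))) with (reflect (H mu lambda lp fp) z) in Hm.
    rewrite (Rp z HVp Hz1), (Rm z HVm Hz1) in Hm.
    set (h := H mu lambda lp (reflect fp) z) in *.
    set (k := H mu lambda lm (reflect fm) z) in *.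
    assert (Hh : h <> RtoC 0) by apply H_neq_0.
    assert (Hk : k <> RtoC 0) by apply H_neq_0.
    assert (Hh' := Cconj_neq_0 _ Hh).
    assert (P := Hpsi' (Cconj h)). rewrite Cmod_conj, Cconj_conj in P.
    specialize (P Hs Hh').
    rewrite Cinv_conj in Hm by exact Hh.
    apply (f_equal Cconj) in Hm. rewrite Cconj_conj in Hm. rewrite <- Hm in P.
    rewrite Cdiv_conj in P by exact Hk.
    apply (f_equal Cconj) in P. rewrite Cconj_conj in P. rewrite P.
    unfold E. rewrite Cconj_RtoC. fold E.
    replace (E / (E / Cconj k))%C with (Cconj k).
    + now rewrite Cconj_conj.
    + field. split; [now apply Cconj_neq_0 | exact HE].
  - generalize (filter_and _ _ (locally_0_conj _ M0)
      (filter_and _ _ (Cmod_locally_0 1 Rlt_0_1)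
         (locally_0_conj _ (H_small_on_Vzero mu lambda lp lm fp d Hl HL Hf Hd)))).
    apply filter_imp. intros z [Hm [Hz1 Hs]] Hz.
    specialize (Hm (Vinfty_conj _ Hz)). specialize (Hs (Vinfty_conj _ Hz)).
    assert (HVp : Vplus z) by apply Hz. assert (HVm : Vminus z) by apply Hz.
    apply (f_equal Cconj) in Hm.
    change (reflect (H mu lambda lm fm) z
      = Cconj (psi0 (H mu lambda lp fp (Cconj z)))) in Hm.
    rewrite <- (Cconj_conj (H mu lambda lp fp (Cconj z))) in Hm.
    rewrite <- Cmod_conj in Hs.
    change (Cconj (H mu lambda lp fp (Cconj z)))
      with (reflect (H mu lambda lp fp) z) in Hm, Hs.
    rewrite (Rp z HVp Hz1) in Hm, Hs. rewrite (Rm z HVm Hz1) in Hm.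
    set (h := H mu lambda lp (reflect fp) z) in *.
    set (k := H mu lambda lm (reflect fm) z) in *.
    assert (Hh : h <> RtoC 0) by apply H_neq_0.
    assert (Hk : k <> RtoC 0) by apply H_neq_0.
    assert (Hh' : (/ h)%C <> RtoC 0).
    { intros E0. apply C1_nz. rewrite <- (Cinv_r h Hh), E0. ring. }
    rewrite (Hpsi' _ Hs Hh') in Hm.
    replace (/ / h)%C with h in Hm by (field; exact Hh).
    (* Were [psiinf h] zero, the convention [/ 0 = 0] would make the right-hand
       side of [Hm] vanish, whereas the left-hand side does not. *)
    assert (Hv : psiinf h <> RtoC 0).
    { intros E0. rewrite E0 in Hm.
      assert (Z : (E / RtoC 0)%C = RtoC 0).
      { unfold Cdiv, Cmult, Cinv, RtoC; simpl. f_equal; unfold Rdiv; ring. }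
      rewrite Z in Hm. apply HE. rewrite <- (Cmult_1_r E), <- (Cinv_l k Hk), Cmult_assoc.
      change ((E / k) * k = RtoC 0)%C. rewrite Hm. ring. }
    transitivity (E / (E / k))%C; [|rewrite Hm]; field; repeat split; trivial.
Qed.

(** * Reality of the spherical normal form *)

Lemma spherical_series_conj (mu lambda : R) (psi0 psiinf : C -> C) (F : nat -> C) :
  0 < lambda ->
  locally (RtoC 0) (fun h : C => h <> RtoC 0 ->
      Cconj (psi0 (Cconj h))
        = (RtoC (exp (4 * PI ^ 2 * mu)) / psiinf (/ h))%C) ->
  spherical_series mu lambda psi0 psiinf F ->
  spherical_series mu lambda psi0 psiinf (ps_conj F).
Proof.
  intros Hl Hpsi [F0 [[D [HD HP]] [fp [fm [Hs [Hfp [Hfm HM]]]]]]].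
  split; [|split].
  - unfold ps_conj. rewrite F0. apply Cconj_RtoC.
  - exists (reflect D). split.
    + rewrite <- ps_conj_XF, <- ps_conj_time_one_map. now apply converges_to_germ_reflect.
    + now apply Parab1_reflect.
  - exists (reflect fp), (reflect fm). split; [|split; [|split]].
    + now apply is_one_sum_reflect.
    + intros z Hz. unfold reflect. rewrite Cmod_conj. apply Hfp, Vplus_conj, Hz.
    + intros z Hz. unfold reflect. rewrite Cmod_conj. apply Hfm, Vminus_conj, Hz.
    + now apply has_modulus_reflect.
Qed.

Theorem mainTheorem4 :
  forall (mu : R) (psi0 psiinf : C -> C),
    biholomorphism_germ_0 psi0 ->
    is_derive psi0 (RtoC 0) (RtoC (exp (4 * PI ^ 2 * mu))) ->
    biholomorphism_germ_0 (at_infinity psiinf) ->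
    tangent_to_id_at_infinity psiinf ->
  forall lambda_psi : R,
    admissible_bound mu psi0 psiinf lambda_psi ->
  forall lambda : R,
    0 < lambda <= lambda_psi ->
  forall Delta : C -> C,
    spherical_normal_form mu lambda psi0 psiinf Delta ->
    locally (RtoC 0) (fun h : C => h <> RtoC 0 ->
      Cconj (psi0 (Cconj h))
        = (RtoC (exp (4 * PI ^ 2 * mu)) / psiinf (/ h))%C) ->
    commutes_with_conj Delta.
Proof.
  intros mu psi0 psiinf _ _ _ _ lambda_psi [_ Hadm] lambda Hlam Delta
    [F [HF HD]] Hpsi.
  destruct (Hadm lambda Hlam) as [G [_ Huniq]].
  assert (Hreal : ps_conj F = F).
  { transitivity G; [symmetry|]; apply Huniq; trivial.
    apply spherical_series_conj; trivial. apply Hlam. }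
  apply (commutes_with_conj_of_real_series (time_one_map (XF mu lambda F))); trivial.
  now rewrite ps_conj_time_one_map, ps_conj_XF, Hreal.
Qed.
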